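(* Let $z_i=f_\theta(x_i)$, $i=1,\dots,N$, be the embeddings of samples $x_1,\dots,x_N$, let $d$ be any chosen metric on embeddings, let $\tau>0$ be a temperature and $$\mathcal R_{\rm log}(G)=\sum_{i\ne j}\tau\,G_{i,j}\big(\log(G_{i,j})-1\big).$$ Consider the graph weight estimate $$\widehat G_{d,\mathcal R_{\rm log}}=\operatorname*{argmin}_{G\in\mathcal S}\ \sum_{i,j}d(z_i,z_j)\,G_{i,j}+\mathcal R_{\rm log}(G),$$ where the feasible set $\mathcal S$ is either $\mathcal G$ or $\mathcal G_{\rm rsto}$. Then $$(\widehat G_{d,\mathcal R_{\rm log}})_{i,j}=e^{-\frac1\tau d(z_i,z_j)}\,1_{\{i\ne j\}}\qquad(\text{with }\mathcal S=\mathcal G),$$ $$(\widehat G_{d,\mathcal R_{\rm log}})_{i,j}=\frac{e^{-\frac1\tau d(z_i,z_j)}}{\sum_{k\ne i}e^{-\frac1\tau d(z_i,z_k)}}\,1_{\{i\ne j\}}\qquad(\text{with }\mathcal S=\mathcal G_{\rm rsto}).$$ Thus, if $d$ is the cosine distance, the second formula recovers the SimCLR similarity estimate, and if $d$ is the $\ell_2$ distance, the second formula recovers the Lifted Structured Loss.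
   Context: $\mathcal G$ is the set of symmetric $N\times N$ matrices with nonnegative entries and zero diagonal. $\mathcal G_{\rm rsto}=\{G\in\mathcal G: G\mathbf 1=\mathbf 1\}$ is the subset of $\mathcal G$ of matrices whose rows sum to $1$. The cosine distance is $d(z,z')=1-\mathrm{CosSim}(z,z')$ with $\mathrm{CosSim}(z,z')=\frac{\langle z,z'\rangle}{\|z\|_2\|z'\|_2}$. The SimCLR similarity estimate with temperature $\tau$ is the $N\times N$ matrix with entries $\frac{e^{\mathrm{CosSim}(z_i,z_j)/\tau}}{\sum_{k\ne i}e^{\mathrm{CosSim}(z_i,z_k)/\tau}}\,1_{\{i\ne j\}}$. ''Recovers the Lifted Structured Loss'' refers to the similarity estimate with entries $\frac{e^{-\|z_i-z_j\|_2/\tau}}{\sum_{k\ne i}e^{-\|z_i-z_k\|_2/\tau}}1_{\{i\ne j\}}$ associated with that metric-learning loss.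
   Formalization: The second formula fails over symmetric G_rsto, as the softmax need not be symmetric. For N>1 it is proved with symmetry of G dropped, and over G_rsto itself exactly when the softmax matrix is symmetric. The metric d need only be symmetric. *)

(* Defs.v *)
From mathcomp Require Import all_boot all_order all_algebra.
From mathcomp Require Import classical_sets reals sequences exp.

Set Implicit Arguments.
Unset Strict Implicit.
Unset Printing Implicit Defensive.

Import Order.TTheory GRing.Theory Num.Theory.
Local Open Scope ring_scope.
Local Open Scope classical_set_scope.

Section Argmin.
Context {R : realType} {T : Type}.

(* Set-valued: [argmin S f = [set x]] says that [x] is the unique minimizer. *)
Definition argmin (S : set T) (f : T -> R) : set T :=
  [set x | S x /\ forall y, S y -> f x <= f y].

End Argmin.

Section Embeddings.
Context {R : realType} {K : nat}.
Implicit Types u v : 'rV[R]_K.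

Definition inner u v : R := \sum_(k < K) u 0 k * v 0 k.

(* The library norm on row vectors is the sup norm, hence this definition. *)
Definition norm2 u : R := Num.sqrt (\sum_(k < K) u 0 k ^+ 2).

(* [cos_sim u v] is [0] if [u] or [v] is the zero vector. *)
Definition cos_sim u v : R := inner u v / (norm2 u * norm2 v).

Definition cos_dist u v : R := 1 - cos_sim u v.

Definition l2_dist u v : R := norm2 (u - v).

End Embeddings.

Section FeasibleSets.
Context {R : realType} {N : nat}.

Definition graphs : set 'M[R]_N :=
  [set G | [/\ G^T = G, forall i j, 0 <= G i j & forall i, G i i = 0]].

Definition graphs_rsto : set 'M[R]_N :=
  [set G | graphs G /\ forall i, \sum_j G i j = 1].

(* Right-stochastic weights of directed graphs: [graphs_rsto] without the
   symmetry constraint. The row-wise softmax of a symmetric matrix lies here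
   but is in general not symmetric, hence not in [graphs_rsto]. *)
Definition digraphs_rsto : set 'M[R]_N :=
  [set G | [/\ forall i j, 0 <= G i j, forall i, G i i = 0
             & forall i, \sum_j G i j = 1]].

End FeasibleSets.

Section Estimates.
Context {R : realType} {N K : nat}.
Implicit Types (d : 'rV[R]_K -> 'rV[R]_K -> R) (tau : R) (z : 'I_N -> 'rV[R]_K).

(* The convention [0 * log 0 = 0] holds because [ln 0 = 0]. *)
Definition R_log tau (G : 'M[R]_N) : R :=
  \sum_i \sum_(j | i != j) tau * G i j * (ln (G i j) - 1).

Definition objective d tau z (G : 'M[R]_N) : R :=
  \sum_i \sum_j d (z i) (z j) * G i j + R_log tau G.

Definition exp_graph d tau z : 'M[R]_N :=
  \matrix_(i, j) (expR (- (1 / tau) * d (z i) (z j)) * (i != j)%:R).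

Definition softmax_graph d tau z : 'M[R]_N :=
  \matrix_(i, j) (expR (- (1 / tau) * d (z i) (z j))
    / (\sum_(k | k != i) expR (- (1 / tau) * d (z i) (z k))) * (i != j)%:R).

Definition simclr_graph tau z : 'M[R]_N :=
  \matrix_(i, j) (expR (cos_sim (z i) (z j) / tau)
    / (\sum_(k | k != i) expR (cos_sim (z i) (z k) / tau)) * (i != j)%:R).

Definition lifted_structured_graph tau z : 'M[R]_N :=
  \matrix_(i, j) (expR (- norm2 (z i - z j) / tau)
    / (\sum_(k | k != i) expR (- norm2 (z i - z k) / tau)) * (i != j)%:R).

End Estimates.

(* Main.v *)
(** Up to a constant on the feasible set, [objective d tau z G] is [tau] times
    the sum over [i != j] of the Bregman divergence of [x * ln x] from [H i j]
    to [G i j], where [H] is the claimed minimizer. The divergence is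
    nonnegative and vanishes only when [G i j = H i j]. For the softmax the
    normalization of row [i] enters through its logarithm times the row sum of
    [G], which is constant on right-stochastic matrices. *)
Require Import Defs.
From mathcomp Require Import all_boot all_order all_algebra.
From mathcomp Require Import classical_sets reals sequences exp.
From mathcomp Require Import ring.

Import Order.TTheory GRing.Theory Num.Theory.
Local Open Scope ring_scope.
Local Open Scope classical_set_scope.

(** At [x = 0] the product vanishes and the value is [a], the continuous extension. *)
Definition bregman {R : realType} (x a : R) : R := x * (ln x - ln a) - x + a.

Lemma bregmanxx {R : realType} (a : R) : bregman a a = 0.
Proof. by rewrite /bregman; ring. Qed.

(** For [0 < x] this is the strict inequality [1 + y < expR y] at [y = ln (a / x)], multiplied by
    [x]. *)
Lemma bregman_gt0 {R : realType} (x a : R) :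
  0 <= x -> 0 < a -> x != a -> 0 < bregman x a.
Proof.
rewrite le0r => /orP[/eqP->|x0] a0 xa.
  by rewrite /bregman mul0r subr0 add0r.
have ax0 : 0 < a / x by rewrite divr_gt0.
have lnax : ln (a / x) = ln a - ln x by rewrite ln_div ?posrE.
have ln_neq0 : ln (a / x) != 0.
  by rewrite lnax subr_eq0; apply: contra_neq xa => /ln_inj->; rewrite ?posrE.
have := expR_gt1Dx ln_neq0.
rewrite lnK ?posrE// -subr_gt0 -(pmulr_rgt0 _ x0) lnax.
by congr (0 < _); rewrite /bregman; field; rewrite gt_eqF.
Qed.

Lemma bregman_ge0 {R : realType} (x a : R) :
  0 <= x -> 0 < a -> 0 <= bregman x a.
Proof.
move=> x0 a0; have [->|xa] := eqVneq x a; first by rewrite bregmanxx.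
by rewrite ltW// bregman_gt0.
Qed.

Lemma argmin_bregman {R : realType} {N : nat} (S : set 'M[R]_N)
    (F : 'M[R]_N -> R) (H : 'M[R]_N) (c tau : R) :
  0 < tau -> S H -> (forall i j, i != j -> 0 < H i j) ->
  (forall G, S G -> forall i j, 0 <= G i j) ->
  (forall G, S G -> forall i, G i i = 0) ->
  (forall G, S G ->
    F G = c + tau * \sum_i \sum_(j | i != j) bregman (G i j) (H i j)) ->
  argmin S F = [set H].
Proof.
move=> tau0 SH H0 S0 Sdiag FE.
have B0 G : S G -> forall i j, i != j -> 0 <= bregman (G i j) (H i j).
  by move=> SG i j ij; rewrite bregman_ge0 ?S0// H0.
have FH : F H = c.
  rewrite FE// big1 ?mulr0 ?addr0// => i _.
  by rewrite big1// => j _; rewrite bregmanxx.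
apply/seteqP; split=> [G [SG /(_ _ SH)]|_ ->] /=.
  (* Comparing a minimizer [G] with [H] makes the divergence sum nonpositive, so a single positive
     term is contradictory. The sum skips the diagonal, where both matrices vanish. *)
  rewrite FH FE// gerDl pmulr_rle0// => sum_le0.
  apply/matrixP => i j; have [<-|ij] := eqVneq i j; first by rewrite !Sdiag.
  apply/eqP/negPn/negP => GHij.
  have := bregman_gt0 _ _ (S0 _ SG i j) (H0 _ _ ij) GHij.
  rewrite ltNge => /negP; apply; apply: le_trans sum_le0.
  rewrite (bigD1 i)//= (bigD1 j)//= -addrA lerDl addr_ge0// sumr_ge0//.
    by move=> k /andP[ik _]; exact: B0.
  by move=> k _; rewrite sumr_ge0// => l kl; exact: B0.
split=> // G SG; rewrite FH FE// lerDl mulr_ge0 ?(ltW tau0)//.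
by apply: sumr_ge0 => i _; apply: sumr_ge0 => j ij; exact: B0.
Qed.

(** Taking logarithms in the form of [H] gives [d (z i) (z j) = tau * (ln (s i) - ln (H i j))],
    which is substituted into the objective. The factor [s i] is [1] for the exponential graph and
    the inverse row normalizer for the softmax. *)
Lemma objective_bregman {R : realType} {N K : nat}
    (d : 'rV[R]_K -> 'rV[R]_K -> R) (tau : R) (z : 'I_N -> 'rV[R]_K)
    (s : 'I_N -> R) (G H : 'M[R]_N) :
  0 < tau -> (forall i, 0 < s i) -> (forall i, G i i = 0) ->
  (forall i j, i != j -> H i j = expR (- (1 / tau) * d (z i) (z j)) * s i) ->
  objective d tau z G =
    tau * \sum_i (ln (s i) * (\sum_j G i j) - \sum_(j | i != j) H i j)
    + tau * \sum_i \sum_(j | i != j) bregman (G i j) (H i j).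
Proof.
move=> tau0 s0 Gdiag HE; rewrite -mulrDr -big_split mulr_sumr.
rewrite /objective /R_log -big_split; apply: eq_bigr => i _ /=.
have off_diag (h : 'I_N -> R) :
    \sum_j h j * G i j = \sum_(j | i != j) h j * G i j.
  rewrite (bigD1 i)//= Gdiag mulr0 add0r.
  by apply: eq_bigl => j; rewrite eq_sym.
rewrite off_diag [ln _ * _]mulr_sumr (off_diag (fun=> ln (s i))).
rewrite -sumrB -!big_split mulr_sumr; apply: eq_bigr => j ij /=.
rewrite /bregman HE// lnM ?posrE ?expR_gt0// expRK.
by field; rewrite gt_eqF.
Qed.

Lemma exp_graph_graphs {R : realType} {N K : nat}
    (d : 'rV[R]_K -> 'rV[R]_K -> R) (tau : R) (z : 'I_N -> 'rV[R]_K) :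
  (forall u v, d u v = d v u) -> graphs (exp_graph d tau z).
Proof.
move=> d_sym; split=> [|i j|i].
- by apply/matrixP => i j; rewrite !mxE d_sym eq_sym.
- by rewrite mxE mulr_ge0 ?expR_ge0.
- by rewrite mxE eqxx mulr0.
Qed.

Lemma argmin_graphs {R : realType} {N K : nat}
    (d : 'rV[R]_K -> 'rV[R]_K -> R) (tau : R) (z : 'I_N -> 'rV[R]_K) :
  (forall u v, d u v = d v u) -> 0 < tau ->
  argmin graphs (objective d tau z) = [set exp_graph d tau z].
Proof.
move=> d_sym tau0.
(* The [0] is [ln 1] times the row sum, which is unconstrained here. *)
pose c := tau * \sum_i (0 - \sum_(j | i != j) exp_graph d tau z i j).
apply: (@argmin_bregman _ _ _ _ _ c tau) => //.
- exact: exp_graph_graphs.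
- by move=> i j ij; rewrite mxE ij mulr1 expR_gt0.
- by move=> G [].
- by move=> G [].
move=> G [_ _ Gdiag].
rewrite (@objective_bregman _ _ _ d tau z (fun=> 1) G (exp_graph d tau z))//.
  by rewrite /c; under eq_bigr do rewrite ln1 mul0r.
by move=> i j ij; rewrite mxE ij.
Qed.

Section Softmax.
Context {R : realType} {N K : nat}.
Variables (d : 'rV[R]_K -> 'rV[R]_K -> R) (tau : R) (z : 'I_N -> 'rV[R]_K).
Hypothesis N_gt1 : (1 < N)%N.

Let Z i := \sum_(k | k != i) expR (- (1 / tau) * d (z i) (z k)).

Lemma softmax_denominator_gt0 i : 0 < Z i.
Proof.
have /card_gt0P[k ki] : (0 < #|predC1 i|)%N.
  by rewrite cardC1 card_ord; case: N N_gt1 => [|[]].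
rewrite /Z (bigD1 k)//= ltr_wpDr ?expR_gt0// sumr_ge0// => j _.
exact: expR_ge0.
Qed.

Lemma softmax_graph_digraphs_rsto : digraphs_rsto (softmax_graph d tau z).
Proof.
split=> [i j|i|i].
- by rewrite mxE mulr_ge0// divr_ge0 ?expR_ge0// ltW// softmax_denominator_gt0.
- by rewrite mxE eqxx mulr0.
rewrite (bigD1 i)//= mxE eqxx mulr0 add0r.
under eq_bigr => j ji do rewrite mxE eq_sym ji mulr1.
by rewrite -mulr_suml mulfV// gt_eqF// softmax_denominator_gt0.
Qed.

(** The set [S] is left general to cover both [digraphs_rsto] and, when the softmax is symmetric,
    [graphs_rsto]. *)
Lemma argmin_softmax_graph (S : set 'M[R]_N) :
  0 < tau -> S `<=` digraphs_rsto -> S (softmax_graph d tau z) ->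
  argmin S (objective d tau z) = [set softmax_graph d tau z].
Proof.
move=> tau0 SD SH; set H := softmax_graph d tau z.
have HE i j : i != j -> H i j = expR (- (1 / tau) * d (z i) (z j)) * (Z i)^-1.
  by move=> ij; rewrite mxE ij mulr1.
have s0 i : 0 < (Z i)^-1 by rewrite invr_gt0 softmax_denominator_gt0.
pose c := tau * \sum_i (ln (Z i)^-1 * 1 - \sum_(j | i != j) H i j).
apply: (@argmin_bregman _ _ _ _ _ c tau) => //.
- by move=> i j ij; rewrite HE// mulr_gt0 ?expR_gt0.
- by move=> G /SD[].
- by move=> G /SD[].
move=> G /SD[_ Gdiag G1].
rewrite (@objective_bregman _ _ _ d tau z (fun i => (Z i)^-1) G H)//.
by rewrite /c; under eq_bigr do rewrite G1.
Qed.

Lemma softmax_graph_graphs_rsto :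
  (softmax_graph d tau z)^T = softmax_graph d tau z ->
  graphs_rsto (softmax_graph d tau z).
Proof. by move=> sym; have [? ? ?] := softmax_graph_digraphs_rsto. Qed.

End Softmax.

(* The constant [1] in [cos_dist] cancels between numerator and denominator. *)
Lemma softmax_graph_cos_dist {R : realType} {N K : nat} (tau : R)
    (z : 'I_N -> 'rV[R]_K) :
  softmax_graph cos_dist tau z = simclr_graph tau z.
Proof.
have cosE i j : expR (- (1 / tau) * cos_dist (z i) (z j)) =
    expR (- (1 / tau)) * expR (cos_sim (z i) (z j) / tau).
  by rewrite -expRD /cos_dist; congr expR; ring.
apply/matrixP => i j; rewrite !mxE cosE.
under eq_bigr do rewrite cosE.
by rewrite -mulr_sumr -mulf_div divff ?mul1r// gt_eqF// expR_gt0.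
Qed.

Lemma softmax_graph_l2_dist {R : realType} {N K : nat} (tau : R)
    (z : 'I_N -> 'rV[R]_K) :
  softmax_graph l2_dist tau z = lifted_structured_graph tau z.
Proof.
have l2E i j : - (1 / tau) * l2_dist (z i) (z j) = - norm2 (z i - z j) / tau.
  by rewrite /l2_dist; ring.
by apply/matrixP => i j; rewrite !mxE l2E; under eq_bigr do rewrite l2E.
Qed.

(** Row normalizers may differ, so the softmax can fail to be symmetric; over [graphs_rsto] the
    formula therefore holds exactly under symmetry. For [N = 1] a zero diagonal excludes row sum
    [1], so both stochastic sets are empty. *)
Theorem theorem4 (R : realType) (N K : nat) (Theta X : Type)
    (f : Theta -> X -> 'rV[R]_K) (theta : Theta) (x : 'I_N -> X)
    (d : 'rV[R]_K -> 'rV[R]_K -> R) (d_sym : forall u v, d u v = d v u)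
    (tau : R) (tau_gt0 : 0 < tau) :
  let z := fun i => f theta (x i) in
  [/\ argmin graphs (objective d tau z) = [set exp_graph d tau z],
      (1 < N)%N ->
        argmin digraphs_rsto (objective d tau z)
          = [set softmax_graph d tau z],
      (1 < N)%N ->
        (argmin graphs_rsto (objective d tau z)
           = [set softmax_graph d tau z]
         <-> (softmax_graph d tau z)^T = softmax_graph d tau z),
      d = cos_dist -> softmax_graph d tau z = simclr_graph tau z
    & d = l2_dist -> softmax_graph d tau z = lifted_structured_graph tau z].
Proof.
move=> z; split=> [|N1|N1|->|->].
- exact: argmin_graphs.
- exact/argmin_softmax_graph/softmax_graph_digraphs_rsto.
- split=> [argminE|sym].
    (* A minimizer is feasible, hence symmetric. *)
    have : [set softmax_graph d tau z] (softmax_graph d tau z) by [].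
    by rewrite -argminE => -[[[]]].
  apply: argmin_softmax_graph => //; last exact: softmax_graph_graphs_rsto.
  by move=> G [[_ G0 Gdiag] G1].
- exact: softmax_graph_cos_dist.
- exact: softmax_graph_l2_dist.
Qed.
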